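(* Let $(A,A')$ be a filtered opca with a pseudo $\mathcal{D}$-algebra structure $\bigvee:\mathcal{D}A\to A$. Then the following are equivalent: (1) (condition $(\ast)$) there is an element $v\in A'$ such that for all $\alpha\in\mathcal{D}A$ and $b,c\in A$: if for each $a\in\alpha$, $ab$ is defined and $ab\leq c$, then $v(\bigvee\alpha)b$ is defined and $v(\bigvee\alpha)b\leq c$; (2) $\bigvee$ is an applicative morphism of filtered opcas $\mathcal{D}(A,A')\to(A,A')$.
   Context: Convention: for partial operations, an expression such as $xy\leq z$ includes the assertion that $xy$ is defined; application associates to the left. An opca is a poset $(A,\leq)$ with a partial binary application $a,b\mapsto ab$ such that: (i) if $ab$ is defined, $a'\leq a$ and $b'\leq b$, then $a'b'$ is defined and $a'b'\leq ab$; (ii) there are $\mathsf{k},\mathsf{s}\in A$ such that $\mathsf{k}xy\leq x$ for all $x,y$; $\mathsf{s}xy$ is defined for all $x,y$; and whenever $xz(yz)$ is defined, $\mathsf{s}xyz$ is defined and $\mathsf{s}xyz\leq xz(yz)$. A filtered opca $(A,A')$ is an opca $A$ with a subset $A'\subseteq A$ closed under (defined) application and containing choices for $\mathsf{k}$ and $\mathsf{s}$. $\mathcal{D}A$ is the set of downwards closed subsets of $A$ ordered by inclusion; ${\downarrow}X$ is the downwards closure of $X$ and ${\downarrow}a={\downarrow}\{a\}$. $\mathcal{D}(A,A')$ is the filtered opca with underlying poset $\mathcal{D}A$, with $\alpha\beta$ defined iff $ab$ is defined for all $a\in\alpha$, $b\in\beta$, in which case $\alpha\beta={\downarrow}\{ab\mid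 a\in\alpha,b\in\beta\}$, and with filter $\{\alpha\in\mathcal{D}A\mid\alpha\cap A'\neq\emptyset\}$. A pseudo $\mathcal{D}$-algebra structure on $(A,A')$ is a function $\bigvee:\mathcal{D}A\to A$ such that: 1) there is $u\in A'$ such that for all $\alpha\subseteq\alpha'$ in $\mathcal{D}A$, $u(\bigvee\alpha)\leq\bigvee\alpha'$; 2) for all $f\in A'$ there is $g_2\in A'$ such that for all $\alpha\in\mathcal{D}A$: if $fx$ is defined for all $x\in\alpha$, then $g_2(\bigvee\alpha)\leq\bigvee({\downarrow}\{fx\mid x\in\alpha\})$; 3) there are $g_3,h_3\in A'$ such that for all $\mathcal{A}\in\mathcal{D}\mathcal{D}A$: $g_3(\bigvee({\downarrow}\{\bigvee\alpha\mid\alpha\in\mathcal{A}\}))\leq\bigvee(\bigcup\mathcal{A})$ and $h_3(\bigvee(\bigcup\mathcal{A}))\leq\bigvee({\downarrow}\{\bigvee\alpha\mid\alpha\in\mathcal{A}\})$; 4) there are $g_4,h_4\in A'$ such that for all $a\in A$: $g_4(\bigvee({\downarrow}a))\leq a$ and $h_4a\leq\bigvee({\downarrow}a)$. An applicative morphism $(A,A')\to(B,B')$ of filtered opcas is a function $f:A\to B$ such that: (i) for all $a\in A'$ there is $b\in B'$ with $b\leq f(a)$; (ii) there is $r\in B'$ such that for all $a',a\in A$, whenever $a'a$ is defined, $rf(a')f(a)$ is defined and $rf(a')f(a)\leq f(a'a)$; (iii) there is $u\in B'$ such that for every $x\leq y$ in $A$, $uf(x)$ is defined and $uf(x)\leq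 f(y)$. *)

(* Defs.v *)
From HB Require Import structures.
From mathcomp Require Import all_boot all_order.
From mathcomp Require Import boolp classical_sets.

Set Implicit Arguments.
Unset Strict Implicit.
Unset Printing Implicit Defensive.

Import Order.TTheory.
Local Open Scope classical_set_scope.
Local Open Scope order_scope.

(* Partial expressions over a poset are elements of [option A], [None] meaning
   "undefined".  [t <~ t'] asserts that both sides are defined and t <= t'. *)
Definition pdef (A : Type) (t : option A) : Prop := exists x, t = Some x.

Definition ple d (A : porderType d) (t t' : option A) : Prop :=
  exists x y, [/\ t = Some x, t' = Some y & x <= y].

Definition papp (A : Type) (app : A -> A -> option A) (t t' : option A)
    : option A :=
  if t is Some x then if t' is Some y then app x y else None else None.

Notation "x %:T" := (Some x) (at level 2, left associativity, format "x %:T").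
Notation "t <~ t'" := (ple t t') (at level 70, no associativity).

Definition app_monotone d (A : porderType d) (app : A -> A -> option A) : Prop :=
  forall a a' b b' : A, pdef (app a b) -> a' <= a -> b' <= b ->
    app a' b' <~ app a b.

Notation "t $_ app t'" := (papp app t t')
  (at level 40, app at level 2, t' at level 39, left associativity).

Definition is_k d (A : porderType d) (app : A -> A -> option A) (k : A) : Prop :=
  forall x y : A, k%:T $_app x%:T $_app y%:T <~ x%:T.

Definition is_s d (A : porderType d) (app : A -> A -> option A) (s : A) : Prop :=
  (forall x y : A, pdef (s%:T $_app x%:T $_app y%:T)) /\
  (forall x y z : A,
     pdef (x%:T $_app z%:T $_app (y%:T $_app z%:T)) ->
     s%:T $_app x%:T $_app y%:T $_app z%:T
       <~ x%:T $_app z%:T $_app (y%:T $_app z%:T)).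

HB.mixin Record isOPCA d A of Order.POrder d A := {
  opca_app : A -> A -> option A;
  opca_app_monotone : app_monotone opca_app;
  opca_app_ks : (exists k, is_k opca_app k) /\ (exists s, is_s opca_app s)
}.

#[short(type="opcaType")]
HB.structure Definition OPCA d := { A of Order.POrder d A & isOPCA d A }.

Notation "t $ t'" := (papp opca_app t t') (at level 40, left associativity).

Record filteredOPCA (d : Order.disp_t) := FilteredOPCA {
  fopca :> opcaType d;
  filt : set fopca;
  filt_app : forall a b c : fopca,
    filt a -> filt b -> a%:T $ b%:T = c%:T -> filt c;
  filt_k : exists2 k, filt k & is_k (opca_app : fopca -> _) k;
  filt_s : exists2 s, filt s & is_s (opca_app : fopca -> _) s
}.
Arguments filt {d} _ _.

Definition down_closed d (A : porderType d) (X : set A) : Prop :=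
  forall x y, y <= x -> X x -> X y.

Record downset d (A : porderType d) := Downset {
  dset : set A;
  dset_down : down_closed dset
}.

Notation "x '\ind' alpha" := (dset alpha x) (at level 70, no associativity).

Section DownsetPOrder.
Context d (A : porderType d).
Implicit Types (X : set A) (al be ga : downset A).

Lemma downset_eqP al be : (forall x, x \ind al <-> x \ind be) -> al = be.
Proof.
case: al be => [X hX] [Y hY] /= h.
have e : X = Y by apply/funext => x; apply/propext.
by subst Y; congr Downset; apply: Prop_irrelevance.
Qed.

HB.instance Definition _ := gen_eqMixin (downset A).
HB.instance Definition _ := gen_choiceMixin (downset A).

Definition dle al be : bool := `[< dset al `<=` dset be >].

Fact dle_refl : reflexive dle.
Proof. by move=> al; apply/asboolP. Qed.

Fact dle_anti : antisymmetric dle.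
Proof.
move=> al be /andP[/asboolP h1 /asboolP h2].
by apply: downset_eqP => x; split; [apply: h1 | apply: h2].
Qed.

Fact dle_trans : transitive dle.
Proof.
move=> be al ga /asboolP h1 /asboolP h2.
by apply/asboolP => x /h1 /h2.
Qed.

HB.instance Definition _ :=
  Order.Le_isPOrder.Build (Order.Disp tt tt) (downset A)
    dle_refl dle_anti dle_trans.

Lemma dleP al be : reflect (dset al `<=` dset be) (al <= be).
Proof. exact: asboolP. Qed.

Fact dcl_down X : down_closed [set y | exists2 x, X x & y <= x].
Proof. by move=> x y yx [z Xz xz]; exists z => //; apply: le_trans xz. Qed.

Definition dcl X : downset A := Downset (@dcl_down X).

Definition dpr (a : A) : downset A := dcl [set a].

End DownsetPOrder.

Arguments dcl {d A} X.
Arguments dpr {d A} a.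

Section DownsetUnion.
Context d (A : porderType d) (AA : downset (downset A)).

Fact dbigcup_down : down_closed (\bigcup_(al in dset AA) dset al).
Proof. by move=> x y yx [al ? alx]; exists al => //; apply: dset_down alx. Qed.

Definition dbigcup : downset A := Downset dbigcup_down.

End DownsetUnion.

Arguments dbigcup {d A} AA.

Section DownsetOPCA.
Context d (A : opcaType d).
Implicit Types (al be ga : downset A).

Definition dapp al be : option (downset A) :=
  if `[< forall a b, a \ind al -> b \ind be -> pdef (a%:T $ b%:T) >]
  then (dcl [set c | exists a b,
          [/\ a \ind al, b \ind be & a%:T $ b%:T = c%:T]])%:T
  else None.

Lemma dapp_def al be :
  pdef (dapp al be) <->
  (forall a b, a \ind al -> b \ind be -> pdef (a%:T $ b%:T)).
Proof.
rewrite /dapp; case: asboolP => h; split=> //; first by eexists.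
by case.
Qed.

Lemma dapp_defin al be ga : dapp al be = ga%:T ->
  forall a b, a \ind al -> b \ind be -> pdef (a%:T $ b%:T).
Proof. by move=> e; apply/dapp_def; exists ga. Qed.

Lemma dapp_in al be ga : dapp al be = ga%:T -> forall c, c \ind ga <->
  exists a b c', [/\ a \ind al, b \ind be, a%:T $ b%:T = c'%:T & c <= c'].
Proof.
rewrite /dapp; case: asboolP => // _ [<-] c; split.
  by move=> [c' [a [b [? ? ?]]] ?]; exists a, b, c'.
by move=> [a [b [c' [? ? ? ?]]]]; exists c' => //; exists a, b.
Qed.

Lemma opca_app_le (a a' b b' c : A) : a' <= a -> b' <= b ->
  a%:T $ b%:T = c%:T -> exists2 c', a'%:T $ b'%:T = c'%:T & c' <= c.
Proof.
move=> ha hb e; have [|x [y [ex ey xy]]] := opca_app_monotone _ _ _ _ _ ha hb.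
  by exists c.
by exists x => //; move: ey; rewrite [LHS]e => -[->].
Qed.

Fact dapp_monotone : app_monotone dapp.
Proof.
move=> a a' b b' [c e] /dleP ha /dleP hb.
have [c' e'] : pdef (dapp a' b').
  apply/dapp_def => x y /ha hx /hb hy; exact: dapp_defin e _ _ hx hy.
exists c', c; split=> //; apply/dleP => z /(dapp_in e')[x [y [w [? ? ? ?]]]].
by apply/(dapp_in e); exists x, y, w; split=> //; [apply: ha | apply: hb].
Qed.

Lemma dpr_in (a x : A) : x \ind dpr a <-> x <= a.
Proof. by split=> [[y -> //]|h]; exists a. Qed.

Lemma dpr_is_k (k : A) : is_k opca_app k -> is_k dapp (dpr k).
Proof.
move=> hk al be.
have kd a b : exists e f,
    [/\ k%:T $ a%:T = e%:T, e%:T $ b%:T = f%:T & f <= a].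
  have [f [a' [ef [<-] fa]]] := hk a b.
  by move: ef; rewrite /=; case E: (opca_app k a) => [e|] //= ef; exists e, f.
have [ga ega] : pdef (dapp (dpr k) al).
  apply/dapp_def => x a /dpr_in xk _; have [e [f [h _ _]]] := kd a a.
  by have [c h' _] := opca_app_le xk (lexx a) h; exists c.
have inga x b : x \ind ga -> exists2 a, a \ind al &
    exists2 f, x%:T $ b%:T = f%:T & f <= a.
  move=> /(dapp_in ega)[k' [a [c [/dpr_in k'k ala ec xc]]]].
  have [e [f [h1 h2 fa]]] := kd a b.
  have [c0 h0 c0e] := opca_app_le k'k (lexx a) h1.
  have xe : x <= e by move: h0; rewrite ec => -[c0E]; rewrite -c0E in c0e;
    apply: le_trans c0e.
  have [f' hf' f'f] := opca_app_le xe (lexx b) h2.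
  by exists a => //; exists f' => //; apply: le_trans fa.
have [de ede] : pdef (dapp ga be).
  by apply/dapp_def => x b /(@inga _ b)[a _ [f ? _]] _; exists f.
exists de, al; split=> //=; first by rewrite ega.
apply/dleP => z /(dapp_in ede)[x [b [c [/(@inga _ b)[a ala [f hf fa]] _ e zc]]]].
apply: (dset_down _ ala); apply: le_trans zc _.
by move: hf; rewrite e => -[->].
Qed.

Lemma dpr_is_s (s : A) : is_s opca_app s -> is_s dapp (dpr s).
Proof.
move=> [hs1 hs2].
have sd a b : exists e f, s%:T $ a%:T = e%:T /\ e%:T $ b%:T = f%:T.
  have [f] := hs1 a b; rewrite /=.
  by case E: (opca_app s a) => [e|] //= ef; exists e, f.
have sal al : exists2 ga, dapp (dpr s) al = ga%:T &
    forall x, x \ind ga -> exists2 a, a \ind al &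
      exists2 e, s%:T $ a%:T = e%:T & x <= e.
  have [ga ega] : pdef (dapp (dpr s) al).
    apply/dapp_def => x a /dpr_in xs _; have [e [f [h _]]] := sd a a.
    by have [c h' _] := opca_app_le xs (lexx a) h; exists c.
  exists ga => // x /(dapp_in ega)[s' [a [c [/dpr_in ss ala ec xc]]]].
  exists a => //; have [e [f [h _]]] := sd a a; exists e => //.
  have [c0 h0 c0e] := opca_app_le ss (lexx a) h.
  by move: h0; rewrite ec => -[c0E]; rewrite -c0E in c0e; apply: le_trans c0e.
have salbe al be : exists2 ga, papp dapp (dapp (dpr s) al) be%:T = ga%:T &
    forall x, x \ind ga -> exists a b, [/\ a \ind al, b \ind be &
      exists2 e, s%:T $ a%:T $ b%:T = e%:T & x <= e].
  have [ga -> inga] := sal al.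
  have dd x b : x \ind ga -> exists2 a, a \ind al &
      exists e f, [/\ s%:T $ a%:T $ b%:T = e%:T, x%:T $ b%:T = f%:T & f <= e].
    move=> /inga[a ala [e ee xe]]; exists a => //.
    have [e1 [f1 [h1 h2]]] := sd a b.
    move: h1; rewrite ee => -[?]; subst e1.
    have [f hf ff1] := opca_app_le xe (lexx b) h2.
    by exists f1, f; split=> //; rewrite ee.
  have [de ede] : pdef (dapp ga be).
    by apply/dapp_def => x b /dd - /(_ b)[a _ [e [f [_ ? _]]]] _; exists f.
  exists de => // z /(dapp_in ede)[x [b [c [gax beb ec zc]]]].
  have [a ala [e [f [h1 h2 fe]]]] := dd x b gax.
  exists a, b; split=> //; exists e => //; apply: le_trans zc _.
  by move: h2; rewrite ec => -[->].
split=> [al be|al be ga /= hdef].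
  by have [de] := salbe al be; exists de.
have [de -> inde] := salbe al be.
case E1: (dapp al ga) hdef => [ag|] /=; last by case.
case E2: (dapp be ga) => [bg|] /=; last by case.
move=> [ze eze]; rewrite eze.
have ins x c : x \ind de -> c \ind ga ->
    exists f w, [/\ x%:T $ c%:T = f%:T, f <= w & w \ind ze].
  move=> /inde[a [b [ala beb [e ee xe]]]] gac.
  have [p ep] := dapp_defin E1 ala gac.
  have [q eq] := dapp_defin E2 beb gac.
  have pag : p \ind ag by apply/(dapp_in E1); exists a, c, p.
  have qbg : q \ind bg by apply/(dapp_in E2); exists b, c, q.
  have [w ew] := dapp_defin eze pag qbg.
  have [|f0 [w0 [h1 h2 fw]]] := hs2 a b c.
    by exists w; rewrite ep eq.
  move: h1 h2; rewrite ep eq ee ew => h1 [?]; subst w0.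
  have [f hf ff0] := opca_app_le xe (lexx c) h1.
  exists f, w; split=> //; first exact: le_trans fw.
  by apply/(dapp_in eze); exists p, q, w.
have [et eet] : pdef (dapp de ga).
  by apply/dapp_def => x c dx gc; have [f [w [? _ _]]] := ins x c dx gc; exists f.
exists et, ze; split=> //; apply/dleP => z.
move=> /(dapp_in eet)[x [c [f [dx gc ef zf]]]].
have [f1 [w [h1 f1w zew]]] := ins x c dx gc.
move: h1; rewrite ef => -[?]; subst f1.
by apply: (dset_down _ zew); apply: le_trans f1w.
Qed.

Fact dapp_ks : (exists k, is_k dapp k) /\ (exists s, is_s dapp s).
Proof.
have [[k hk] [s hs]] := @opca_app_ks d A.
by split; [exists (dpr k); apply: dpr_is_k | exists (dpr s); apply: dpr_is_s].
Qed.

HB.instance Definition _ :=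
  isOPCA.Build (Order.Disp tt tt) (downset A) dapp_monotone dapp_ks.

End DownsetOPCA.

Section DownsetFilter.
Context d (A : filteredOPCA d).

Definition dfilt : set (downset A) := [set al | dset al `&` filt A !=set0].

Fact dfilt_app (al be ga : downset A) :
  dfilt al -> dfilt be -> al%:T $ be%:T = ga%:T -> dfilt ga.
Proof.
move=> [a [ala fa]] [b [beb fb]] e.
have [c ec] := dapp_defin e ala beb.
exists c; split; last exact: filt_app ec.
by apply/(dapp_in e); exists a, b, c.
Qed.

Fact dfilt_dpr (a : A) : filt A a -> dfilt (dpr a).
Proof. by move=> fa; exists a; split=> //; apply/dpr_in. Qed.

Fact dfilt_k : exists2 k, dfilt k & is_k (opca_app : downset A -> _) k.
Proof.
have [k fk hk] := filt_k A.
by exists (dpr k); [apply: dfilt_dpr | apply: dpr_is_k].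
Qed.

Fact dfilt_s : exists2 s, dfilt s & is_s (opca_app : downset A -> _) s.
Proof.
have [s fs hs] := filt_s A.
by exists (dpr s); [apply: dfilt_dpr | apply: dpr_is_s].
Qed.

Definition downset_fopca : filteredOPCA (Order.Disp tt tt) :=
  FilteredOPCA dfilt_app dfilt_k dfilt_s.

End DownsetFilter.

Definition pseudo_D_algebra d (A : filteredOPCA d) (join : downset A -> A)
    : Prop :=
  [/\ exists2 u, filt A u &
        forall al al' : downset A, al <= al' ->
          u%:T $ (join al)%:T <~ (join al')%:T,
      forall f, filt A f -> exists2 g, filt A g &
        forall al : downset A,
          (forall x, x \ind al -> pdef (f%:T $ x%:T)) ->
          g%:T $ (join al)%:T <~
            (join (dcl [set y | exists2 x, x \ind al & f%:T $ x%:T = y%:T]))%:T,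
      exists g h, [/\ filt A g, filt A h &
        forall AA : downset (downset A),
          g%:T $ (join (dcl (join @` dset AA)))%:T <~ (join (dbigcup AA))%:T /\
          h%:T $ (join (dbigcup AA))%:T <~ (join (dcl (join @` dset AA)))%:T] &
      exists g h, [/\ filt A g, filt A h &
        forall a : A,
          g%:T $ (join (dpr a))%:T <~ a%:T /\
          h%:T $ a%:T <~ (join (dpr a))%:T]].

Definition applicative_morphism d d' (A : filteredOPCA d) (B : filteredOPCA d')
    (f : A -> B) : Prop :=
  [/\ forall a, filt A a -> exists2 b, filt B b & b <= f a,
      exists2 r, filt B r &
        forall a' a : A, pdef (a'%:T $ a%:T) ->
          exists2 c, a'%:T $ a%:T = c%:T &
            r%:T $ (f a')%:T $ (f a)%:T <~ (f c)%:T &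
      exists2 u, filt B u &
        forall x y : A, x <= y -> u%:T $ (f x)%:T <~ (f y)%:T].

Definition condition_star d (A : filteredOPCA d) (join : downset A -> A) : Prop :=
  exists2 v, filt A v &
    forall (al : downset A) (b c : A),
      (forall a, a \ind al -> a%:T $ b%:T <~ c%:T) ->
      v%:T $ (join al)%:T $ b%:T <~ c%:T.

Arguments pseudo_D_algebra {d} A join.
Arguments applicative_morphism {d d'} A B f.
Arguments condition_star {d} A join.

(* Main.v *)
Require Import Defs.
From HB Require Import structures.
From mathcomp Require Import all_boot all_order.
From mathcomp Require Import boolp classical_sets.

Import Order.TTheory.
Local Open Scope classical_set_scope.
Local Open Scope order_scope.

(** Both implications are programming exercises in the internal language of
    the filtered opca: every operation written with application, variables and
    constants of the filter is realized by an element of the filter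
    ([realize2], the combinatory completeness of opcas).

    Suppose that [join] satisfies the condition with [v].  By the second axiom
    of pseudo algebras, the condition lifts along any [f] of the filter: if
    [f a b <= c] for all [a] in [al], then [f' (join al) b <= c] for some [f']
    of the filter that depends on [f] only ([star_lift]).  Now for [a] in [al]
    and [b] in [be] the element [u (h (a b))] is below the join [c] of the
    product [al be], where [h] and [u] come from the fourth and the first
    axiom.  Realize this as a function of [b], then [a]; lifting replaces [b]
    by [join be]; exchanging the two arguments and lifting again replaces [a]
    by [join al].  This is the tracker of the morphism.  The detour is needed
    because the second axiom applies only to elements of the filter, so that
    it cannot be used for [a] itself.

    Conversely, let [r] track [join] and suppose that [a b <= c] for all [a] in
    [al].  The product of [al] with the principal downset of [b] is contained
    in the principal downset of [c], so [r (join al) (h b)] is sent below [c]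
    by [u] followed by [g], where [g] comes from the fourth axiom
    ([morphism_star]). *)

(** * Inequalities between partial expressions *)

Section PartialOrder.
Context {d : Order.disp_t} {A : opcaType d}.
Implicit Types (t : option A) (a : A).

Lemma ple_refl t : pdef t -> t <~ t.
Proof. by move=> [x ->]; exists x, x. Qed.

Lemma ple_trans t1 t2 t3 : t1 <~ t2 -> t2 <~ t3 -> t1 <~ t3.
Proof.
move=> [x [y [-> -> xy]]] [y' [z [[<-] -> yz]]].
by exists x, z; split=> //; apply: le_trans yz.
Qed.

Lemma ple_defl t1 t2 : t1 <~ t2 -> pdef t1.
Proof. by move=> [x [y [-> _ _]]]; exists x. Qed.

Lemma ple_defr t1 t2 : t1 <~ t2 -> pdef t2.
Proof. by move=> [x [y [_ -> _]]]; exists y. Qed.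

Lemma pdef_appl t1 t2 : pdef (t1 $ t2) -> pdef t1.
Proof. by case: t1 => [x|] [y] // _; exists x. Qed.

Lemma pdef_appr t1 t2 : pdef (t1 $ t2) -> pdef t2.
Proof. by case: t1 t2 => [x|] [y|] [z] // _; exists y. Qed.

Lemma ple_app t1 t1' t2 t2' :
  t1 <~ t1' -> t2 <~ t2' -> pdef (t1' $ t2') -> t1 $ t2 <~ t1' $ t2'.
Proof.
move=> [x [x' [-> -> xx']]] [y [y' [-> -> yy']]] def_xy.
exact: opca_app_monotone def_xy xx' yy'.
Qed.

Lemma ple_app_trans t1 t1' t2 t2' t :
  t1 <~ t1' -> t2 <~ t2' -> t1' $ t2' <~ t -> t1 $ t2 <~ t.
Proof. by move=> le1 le2 le; apply: ple_trans (le); apply/ple_app/ple_defl/le. Qed.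

Lemma ple_appr_trans a t2 t2' t :
  t2 <~ t2' -> a%:T $ t2' <~ t -> a%:T $ t2 <~ t.
Proof. by apply: ple_app_trans; apply: ple_refl; exists a. Qed.

Lemma ple_appl_trans t1 t1' a t :
  t1 <~ t1' -> t1' $ a%:T <~ t -> t1 $ a%:T <~ t.
Proof. by move=> /ple_app_trans; apply; apply: ple_refl; exists a. Qed.

End PartialOrder.

(** * Combinatory completeness *)

Section Polynomials.
Context {d : Order.disp_t} {A : filteredOPCA d}.

Inductive poly (V : Type) : Type :=
  | Var of V
  | Cst of A
  | App of poly V & poly V.
Arguments Var {V}.
Arguments Cst {V}.
Arguments App {V}.

Fixpoint eval {V : Type} (e : V -> A) (p : poly V) : option A :=
  match p with
  | Var i => (e i)%:T
  | Cst a => a%:T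
  | App p q => eval e p $ eval e q
  end.

Fixpoint filt_coefs {V : Type} (p : poly V) : Prop :=
  match p with
  | Var _ => True
  | Cst a => filt A a
  | App p q => filt_coefs p /\ filt_coefs q
  end.

Lemma filt_eval {V : Type} (e : V -> A) (p : poly V) (a : A) :
  (forall i, filt A (e i)) -> filt_coefs p -> eval e p = a%:T -> filt A a.
Proof.
move=> filt_e; elim: p a => [i|b|p IHp q IHq] a /=; [by move=> _ [<-]|..].
  by move=> ? [<-].
move=> [filt_p filt_q].
case Ep: (eval e p) => [x|] //; case Eq: (eval e q) => [y|] // xy.
by apply: filt_app xy; [apply: IHp | apply: IHq].
Qed.

Definition extend {V : Type} (e : V -> A) (a : A) (i : option V) : A :=
  if i is Some j then e j else a.

Section Abstraction.
Context (k s : A) (k_filt : filt A k) (s_filt : filt A s).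
Context (kP : is_k opca_app k) (sP : is_s opca_app s).

(** Bracket abstraction of the variable [None]. *)
Fixpoint lam {V : Type} (p : poly (option V)) : poly V :=
  match p with
  | Var None => App (App (Cst s) (Cst k)) (Cst k)
  | Var (Some i) => App (Cst k) (Var i)
  | Cst a => App (Cst k) (Cst a)
  | App p q => App (App (Cst s) (lam p)) (lam q)
  end.

Lemma filt_coefs_lam {V : Type} (p : poly (option V)) :
  filt_coefs p -> filt_coefs (lam p).
Proof. by elim: p => [[i|]|a|p IHp q IHq] //= [/IHp ? /IHq ?]. Qed.

Lemma k_def (a : A) : pdef (k%:T $ a%:T).
Proof. exact: pdef_appl (ple_defl _ _ (kP a a)). Qed.

(** An abstraction denotes even where its body does not, since [s a b] is
    always defined; this is what makes iterated abstraction possible. *)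
Lemma eval_lam_def {V : Type} (e : V -> A) (p : poly (option V)) :
  pdef (eval e (lam p)).
Proof.
elim: p => [[i|]|a|p [x Ex] q [y Ey]] /=; [exact: k_def| |exact: k_def|].
  exact: (proj1 sP).
by rewrite Ex Ey; apply: (proj1 sP).
Qed.

Lemma eval_lam_le {V : Type} (e : V -> A) (p : poly (option V)) (b : A) :
  pdef (eval (extend e b) p) ->
  eval e (lam p) $ b%:T <~ eval (extend e b) p.
Proof.
elim: p => [[i|]|a|p IHp q IHq] /= def_p; [exact: kP| |exact: kP|].
  have kb := k_def b.
  have kbkb : k%:T $ b%:T $ (k%:T $ b%:T) <~ b%:T.
    by case: (kb) => x Ex; rewrite {2}Ex; apply: kP.
  by apply: ple_trans (kbkb); apply: (proj2 sP); apply: ple_defl kbkb.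
have {}IHp := IHp (pdef_appl _ _ def_p).
have {}IHq := IHq (pdef_appr _ _ def_p).
have le_pq := ple_app _ _ _ _ IHp IHq def_p.
apply: ple_trans (le_pq); move: (ple_defl _ _ le_pq).
have [x ->] := eval_lam_def e p; have [y ->] := eval_lam_def e q.
exact: (proj2 sP).
Qed.

End Abstraction.

(** Combinatory completeness in two variables: [Var (Some None)] is the first
    argument and [Var None] the second one. *)
Lemma realize2 (p : poly (option (option void))) : filt_coefs p ->
  exists2 t, filt A t & forall x y z : A,
    eval (extend (extend (of_void A) x) y) p <~ z%:T ->
    t%:T $ x%:T $ y%:T <~ z%:T.
Proof.
move=> filt_p.
have [k k_filt kP] := filt_k A; have [s s_filt sP] := filt_s A.
pose q := lam k s p.
have [t Et] := eval_lam_def k s kP sP (of_void A) q.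
exists t => [|x y z le_z].
  by apply: filt_eval Et => [[]|]; do 2!apply: filt_coefs_lam => //.
have le_x : t%:T $ x%:T <~ eval (extend (of_void A) x) q.
  by rewrite -Et; apply: eval_lam_le => //; apply: eval_lam_def.
apply: ple_appl_trans le_x _; apply: ple_trans (le_z).
by apply: eval_lam_le => //; apply: ple_defl le_z.
Qed.

End Polynomials.

Arguments Var {d A V}.
Arguments Cst {d A V}.
Arguments App {d A V}.

Local Notation fst_arg := (Var (Some None)).
Local Notation snd_arg := (Var None).

(** * The equivalence *)

Section Equivalence.
Context {d : Order.disp_t} {A : filteredOPCA d} {join : downset A -> A}.
Context (joinP : pseudo_D_algebra A join).

(** The condition transported along [f]: apply it to the downset generated by
    the image of [al] under [f], whose join the second axiom computes from
    [join al]. *)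
Lemma star_lift (f : A) : condition_star A join -> filt A f ->
  exists2 g, filt A g & forall (al : downset A) (b c : A),
    (forall a, a \ind al -> f%:T $ a%:T $ b%:T <~ c%:T) ->
    g%:T $ (join al)%:T $ b%:T <~ c%:T.
Proof.
move=> [v v_filt vP] f_filt.
have [_ /(_ _ f_filt)[g g_filt gP] _ _] := joinP.
have [//|t t_filt tP] :=
  realize2 (App (App (Cst v) (App (Cst g) fst_arg)) snd_arg).
exists t => // al b c le_c; apply: tP => /=.
set im := [set y | exists2 x, x \ind al & f%:T $ x%:T = y%:T].
have g_le : g%:T $ (join al)%:T <~ (join (dcl im))%:T.
  by apply: gP => a /le_c /ple_defl /pdef_appl.
have v_le : v%:T $ (join (dcl im))%:T $ b%:T <~ c%:T.
  apply: vP => y [fa [a al_a Efa] y_le]; have := le_c a al_a; rewrite Efa.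
  by apply: ple_appl_trans; exists y, fa.
apply: ple_appl_trans (v_le); apply: ple_appr_trans (g_le) _.
by apply/ple_refl/pdef_appl/ple_defl/v_le.
Qed.

(** If [a] in [al] belongs to the filter, then [u (h a)] is the required
    element: [h a] lies below the join of the principal downset of [a], which
    [u] maps below [join al]. *)
Lemma join_filt (al : downset A) :
  dfilt al -> exists2 b, filt A b & b <= join al.
Proof.
have [[u u_filt uP] _ _ [g [h [_ h_filt ghP]]]] := joinP.
move=> [a [al_a a_filt]].
have le_join : u%:T $ (h%:T $ a%:T) <~ (join al)%:T.
  apply: ple_appr_trans (proj2 (ghP a)) _; apply: uP.
  by apply/dleP => x /dpr_in x_le; apply: dset_down x_le al_a.
have [b [_ [Eb [<-] b_le]]] := le_join; exists b => //.
have [ha Eha] := pdef_appr _ _ (ple_defl _ _ le_join).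
by rewrite Eha in Eb; apply: filt_app Eb => //; apply: filt_app Eha.
Qed.

(** The condition replaces only a first argument by a join, so it is used twice:
    [t b a], bounded by [u (h (a b))], is lifted in [b], the result is flipped by [w] and
    lifted in [a]. *)
Lemma star_tracker : condition_star A join ->
  exists2 r, filt A r & forall al be ga : downset A, dapp al be = ga%:T ->
    r%:T $ (join al)%:T $ (join be)%:T <~ (join ga)%:T.
Proof.
move=> star.
have [[u u_filt uP] _ _ [g [h [_ h_filt ghP]]]] := joinP.
have [//|t t_filt tP] :=
  realize2 (App (Cst u) (App (Cst h) (App snd_arg fst_arg))).
have [t' t'_filt t'P] := star_lift t star t_filt.
have [//|w w_filt wP] := realize2 (App (App (Cst t') snd_arg) fst_arg).
have [r r_filt rP] := star_lift w star w_filt.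
exists r => // al be ga Ega.
apply: rP => a al_a; apply: wP; apply: t'P => b be_b; apply: tP => /=.
have [ab Eab] := dapp_defin Ega al_a be_b; rewrite [opca_app a b]Eab.
apply: ple_appr_trans (proj2 (ghP ab)) _; apply: uP; apply/dleP => x /dpr_in x_le.
by apply/(dapp_in Ega); exists a, b, ab.
Qed.

Lemma morphism_star :
  applicative_morphism (downset_fopca A) A join -> condition_star A join.
Proof.
have [[u u_filt uP] _ _ [g [h [g_filt h_filt ghP]]]] := joinP.
move=> [_ [r r_filt rP] _].
have [//|v v_filt vP] := realize2
  (App (Cst g) (App (Cst u) (App (App (Cst r) fst_arg) (App (Cst h) snd_arg)))).
exists v => // al b c le_c; apply: vP => /=.
(* The product with the principal downset must be defined, so the bound is
   needed for all [b'] below [b]. *)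
have le_c' a b' : a \ind al -> b' \ind dpr b -> a%:T $ b'%:T <~ c%:T.
  move=> al_a /dpr_in b'_le; apply: ple_appr_trans (le_c a al_a).
  by exists b', b.
have def_al : pdef (dapp al (dpr b)).
  by apply/dapp_def => a b' al_a /(le_c' _ _ al_a) /ple_defl.
have [ga Ega r_le] := rP al (dpr b) def_al.
have ga_le : ga <= dpr c.
  apply/dleP => x /(dapp_in Ega)[a [b' [ab [al_a b_b' Eab x_le]]]].
  have [ab' [_ [Eab' [<-] ab_le]]] := le_c' _ _ al_a b_b'.
  move: Eab'; rewrite Eab => -[Eab']; rewrite -Eab' in ab_le.
  by apply/dpr_in; apply: le_trans ab_le.
apply: ple_appr_trans (proj1 (ghP c)).
apply: ple_appr_trans (uP _ _ ga_le).
apply: ple_app_trans (proj2 (ghP b)) (r_le).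
by apply/ple_refl/pdef_appl/ple_defl/r_le.
Qed.

Lemma star_morphism :
  condition_star A join -> applicative_morphism (downset_fopca A) A join.
Proof.
move=> star; have [[u u_filt uP] _ _ _] := joinP; split.
- exact: join_filt.
- have [r r_filt rP] := star_tracker star.
  by exists r => // al be [ga Ega]; exists ga => //; apply: rP.
- by exists u.
Qed.

End Equivalence.

Theorem theorem1p15 (d : Order.disp_t) (A : filteredOPCA d)
    (join : downset A -> A) (hjoin : pseudo_D_algebra A join) :
  condition_star A join <-> applicative_morphism (downset_fopca A) A join.
Proof.
by split; [apply: star_morphism hjoin | apply: morphism_star hjoin].
Qed.
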